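(* Let $a\in(0,1)$ and let $W_a:L^2(\mathbb{R}_+,dt)\to L^2(\mathbb{R}_+,dt)$ be the bounded linear operator given by $(W_aF)(t)=e^{-t(1-a)}F(at)$. Then $W_a$ is a generalized hyperbolic operator.
   Context: $\mathbb{R}_+=\{t\in\mathbb{R}:t>0\}$ and $L^2(\mathbb{R}_+,dt)$ is the Hilbert space of square-integrable measurable complex-valued functions on $\mathbb{R}_+$ (Lebesgue measure). $r(\cdot)$ denotes the spectral radius. A bounded linear operator $T$ on a complex Banach space $X$ is generalized hyperbolic if there is a direct sum decomposition $X=M\oplus N$, where $M$ and $N$ are closed subspaces of $X$, such that: (1) $T(M)\subset M$ and $r(T|_M)<1$; (2) $T|_N:N\to T(N)$ is bijective, $T(N)$ is closed, $N\subset T(N)$, and $r\big((T|_N)^{-1}|_N\big)<1$, where $(T|_N)^{-1}|_N:N\to N$ is the restriction to $N\subset T(N)$ of the inverse $(T|_N)^{-1}:T(N)\to N$. *)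

(* Defs.v *)
From HB Require Import structures.
From mathcomp Require Import all_boot all_order all_algebra.
From mathcomp Require Import generic_quotient ring_quotient complex.
From mathcomp Require Import all_classical all_reals all_analysis.
From mathcomp Require Import measurable_realfun ring lra.
Set Implicit Arguments.
Unset Strict Implicit.
Unset Printing Implicit Defensive.
Import Order.TTheory GRing.Theory Num.Theory.
Import numFieldNormedType.Exports ComplexField.Normc.
Local Open Scope classical_set_scope.
Local Open Scope complex_scope.
Local Open Scope ring_scope.

Section normc_lemmas.
Context {R : realType}.
Implicit Types z w : R[i].

Lemma normc_normE z : `|z| = (normc z)%:C.
Proof. by case: z => x y; rewrite normc_def. Qed.

Lemma normc_ge0 z : 0 <= normc z.
Proof. by case: z => x y; exact: sqrtr_ge0. Qed.

Lemma normcD z w : normc (z + w) <= normc z + normc w.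
Proof. by rewrite le_normcD. Qed.

Lemma ReD z w : complex.Re (z + w) = complex.Re z + complex.Re w.
Proof. by case: z; case: w. Qed.

Lemma ImD z w : complex.Im (z + w) = complex.Im z + complex.Im w.
Proof. by case: z; case: w. Qed.

Lemma ReM z w : complex.Re (z * w) =
  complex.Re z * complex.Re w - complex.Im z * complex.Im w.
Proof. by case: z; case: w. Qed.

Lemma ImM z w : complex.Im (z * w) =
  complex.Re z * complex.Im w + complex.Im z * complex.Re w.
Proof. by case: z => a b; case: w. Qed.

Lemma normc_real (x : R) : normc x%:C = `|x|.
Proof. by rewrite /= expr0n addr0 sqrtr_sqr. Qed.

End normc_lemmas.

Section L2fun.
Context d (T : measurableType d) (R : realType) (mu : {measure set T -> \bar R}).

(* Measurability for the Borel sigma-algebra of C, which is the product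
   sigma-algebra of R x R. *)
Definition measurableC (f : T -> R[i]) : Prop :=
  measurable_fun setT (@complex.Re R \o f) /\
  measurable_fun setT (@complex.Im R \o f).

Lemma measurable_normc f : measurableC f -> measurable_fun setT (@normc R \o f).
Proof.
move=> [mr mi].
have -> : @normc R \o f =
    Num.sqrt \o (fun t => complex.Re (f t) ^+ 2 + complex.Im (f t) ^+ 2).
  by apply/funext => t /=; case: (f t).
apply: measurableT_comp.
  by apply: continuous_measurable_fun; exact: sqrt_continuous.
by apply: measurable_funD; exact: measurable_funX.
Qed.

Definition square_integrable : {pred T -> R[i]} :=
  mem [set f | measurableC f /\ finite_norm mu 2%:E (@normc R \o f)].

Lemma square_integrableP f : reflect
  (measurableC f /\ finite_norm mu 2%:E (@normc R \o f)) (f \in square_integrable).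
Proof. by apply: (iffP idP); rewrite inE. Qed.

Lemma measurableC_lin a f g : measurableC f -> measurableC g ->
  measurableC (a *: f + g).
Proof.
move=> [fr fi] [gr gi]; split.
  rewrite (_ : _ \o _ = (fun t => complex.Re a * complex.Re (f t) -
      complex.Im a * complex.Im (f t)) \+ (@complex.Re R \o g)); last first.
    by apply/funext => t /=; rewrite ReD ReM.
  apply: measurable_funD => //; apply: measurable_funB;
    exact: measurable_funM.
rewrite (_ : _ \o _ = (fun t => complex.Re a * complex.Im (f t) +
    complex.Im a * complex.Re (f t)) \+ (@complex.Im R \o g)); last first.
  by apply/funext => t /=; rewrite ImD ImM.
by apply: measurable_funD => //; apply: measurable_funD; exact: measurable_funM.
Qed.

Lemma normc_Lfun f : f \in square_integrable -> @normc R \o f \in Lfun mu 2%:E.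
Proof.
move=> /square_integrableP[mf ff]; rewrite !inE/=.
by apply/andP; split; rewrite inE//=; exact: measurable_normc.
Qed.

Lemma measurable_abse_poweR (f : T -> R) (r : R) : measurable_fun setT f ->
  measurable_fun setT (fun t => `|(EFin \o f) t| `^ r)%E.
Proof.
move=> mf; apply: (@measurableT_comp _ _ _ _ _ _ (fun x : \bar R => (x `^ r)%E)).
  exact: measurable_poweR.
by apply: measurableT_comp => //; exact/measurable_EFinP.
Qed.

Lemma Lnorm2E (f : T -> R) :
  (('N[mu]_2%:E[EFin \o f]) `^ 2 = \int[mu]_t (`|f t| ^+ 2)%:E)%E.
Proof.
rewrite powR_Lnorm//; apply: eq_integral => t _ /=.
by rewrite powR_mulrn.
Qed.

Lemma finite_norm2P (f : T -> R) :
  finite_norm mu 2%:E f <-> (\int[mu]_t (`|f t| ^+ 2)%:E < +oo)%E.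
Proof.
rewrite /finite_norm -Lnorm2E; split; first exact: poweR_lty.
exact: lty_poweRy.
Qed.

Lemma Lfun_le (f g : T -> R) : measurable_fun setT f -> g \in Lfun mu 2%:E ->
  (forall t, `|f t| <= `|g t|) -> finite_norm mu 2%:E f.
Proof.
move=> mf gL fg.
have mg : measurable_fun setT g := set_mem (sub_Lfun_mfun gL).
have g2 := (finite_norm2P g).1 (set_mem (sub_Lfun_finLfun gL)).
apply/finite_norm2P; apply: le_lt_trans g2; apply: ge0_le_integral => //.
- by apply/measurable_EFinP; apply: measurable_funX; exact: measurableT_comp.
- by apply/measurable_EFinP; apply: measurable_funX; exact: measurableT_comp.
- by move=> t _; rewrite lee_fin lerXn2r ?nnegrE.
Qed.

Lemma square_integrable_submod : submod_closed square_integrable.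
Proof.
split.
  apply/square_integrableP; split.
    by split; exact: measurable_cst.
  rewrite (_ : _ \o _ = cst 0); last by apply/funext => t; exact: normc0.
  by apply: finite_norm_cst0; rewrite lee_fin ler1n.
move=> a f g /= f2 g2; apply/square_integrableP.
have mfg : measurableC (a *: f + g).
  by apply: measurableC_lin; [case/square_integrableP: f2|case/square_integrableP: g2].
split=> //.
have p1 : (1 <= 2%:E :> \bar R)%E by rewrite lee_fin ler1n.
have h := (Lfun_submod_closed mu p1).2 (normc a) _ _
  (normc_Lfun f2) (normc_Lfun g2).
apply: (Lfun_le _ h); first exact: measurable_normc.
move=> t /=; rewrite !ger0_norm ?normc_ge0//; last first.
  by rewrite addr_ge0 ?mulr_ge0 ?normc_ge0.
by rewrite (le_trans (normcD _ _))// lerD2r normcM.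
Qed.

HB.instance Definition _ :=
  GRing.isSubmodClosed.Build R[i] (T -> R[i]) square_integrable
    square_integrable_submod.

Record L2fun := L2Fun {
  L2val :> T -> R[i];
  _ : L2val \in square_integrable }.

HB.instance Definition _ := [isSub for L2val].
HB.instance Definition _ := gen_eqMixin L2fun.
HB.instance Definition _ := gen_choiceMixin L2fun.
HB.instance Definition _ := [SubChoice_isSubLmodule of L2fun by <:].

(* L2 is the quotient of the square-integrable functions by the mu-a.e. null
   ones. *)
Definition L2null : {pred L2fun} :=
  mem [set f : L2fun | (f : T -> R[i]) = cst 0 %[ae mu]].

Lemma L2null_zmod : zmod_closed L2null.
Proof.
split.
  by rewrite inE /=; apply: nearW.
move=> f g; rewrite !inE /= => f0 g0.
near=> t => _; rewrite [LHS](_ : _ = f t - g t)//.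
by rewrite (near f0 t)// (near g0 t)// subrr.
Unshelve. all: by end_near. Qed.

HB.instance Definition _ := GRing.isZmodClosed.Build L2fun L2null L2null_zmod.

Definition L2 := Quotient.quot L2null.
HB.instance Definition _ := GRing.Zmodule.on L2.


Local Open Scope quotient_scope.

Definition L2class (f : L2fun) : L2 := \pi_L2 f.

Lemma L2classP (f g : L2fun) :
  L2class f = L2class g <-> (f : T -> R[i]) = g %[ae mu].
Proof.
split.
  move=> /eqP; rewrite /L2class -Quotient.idealrBE inE /= => fg.
  near=> t => _; apply/eqP; rewrite -subr_eq0; apply/eqP.
  exact: (near fg t _ I).
move=> fg; apply/eqP; rewrite /L2class -Quotient.idealrBE inE /=.
near=> t => _; rewrite [LHS](_ : _ = f t - g t)//.
by rewrite (near fg t _ I)// subrr.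
Unshelve. all: by end_near. Qed.

Lemma L2class_repr (x : L2) : L2class (repr x) = x.
Proof. exact: reprK. Qed.

Lemma repr_L2class (f : L2fun) : (repr (L2class f) : T -> R[i]) = f %[ae mu].
Proof. by apply/L2classP; rewrite L2class_repr. Qed.

Lemma L2classD f g : L2class (f + g) = L2class f + L2class g.
Proof. exact: raddfD. Qed.

Definition L2scale (a : R[i]) (x : L2) : L2 := L2class (a *: repr x).

Lemma L2scaleE a f : L2scale a (L2class f) = L2class (a *: f).
Proof.
apply/L2classP; have := repr_L2class f; apply: filterS => t /= /(_ I) ft _.
by rewrite [LHS](_ : _ = a * repr (L2class f) t)// ft.
Qed.

Lemma L2scaleA a b x : L2scale a (L2scale b x) = L2scale (a * b) x.
Proof. by rewrite -[x]L2class_repr !L2scaleE scalerA. Qed.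

Lemma L2scale1 : left_id 1 L2scale.
Proof. by move=> x; rewrite -[x]L2class_repr L2scaleE scale1r. Qed.

Lemma L2scaleDr : right_distributive L2scale +%R.
Proof.
move=> a x y; rewrite -[x]L2class_repr -[y]L2class_repr.
by rewrite -L2classD !L2scaleE scalerDr L2classD.
Qed.

Lemma L2scaleDl x : {morph L2scale^~ x : a b / a + b}.
Proof.
by move=> a b; rewrite -[x]L2class_repr !L2scaleE scalerDl L2classD.
Qed.

HB.instance Definition _ := GRing.Zmodule_isLmodule.Build R[i] L2
  L2scaleA L2scale1 L2scaleDr L2scaleDl.

Lemma L2classZ a f : L2class (a *: f) = a *: L2class f.
Proof. by rewrite -L2scaleE. Qed.

Lemma L2funP (f : L2fun) : measurableC f /\ finite_norm mu 2%:E (@normc R \o f).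
Proof. by apply/square_integrableP; case: f. Qed.

Definition L2fun_norm (f : L2fun) : R :=
  fine ('N[mu]_2%:E[EFin \o (@normc R \o f)])%E.

Definition L2norm (x : L2) : R := L2fun_norm (repr x).

Lemma eq_L2fun_norm (f g : L2fun) : (f : T -> R[i]) = g %[ae mu] ->
  L2fun_norm f = L2fun_norm g.
Proof.
move=> fg; congr fine; rewrite unlock; congr poweR.
apply: ge0_ae_eq_integral => //.
- exact/measurable_abse_poweR/measurable_normc/(L2funP f).1.
- exact/measurable_abse_poweR/measurable_normc/(L2funP g).1.
- by move=> t _; exact: poweR_ge0.
- by move=> t _; exact: poweR_ge0.
- by move: fg; apply: filterS => t /= /[apply] ->.
Qed.

Lemma L2normE f : L2norm (L2class f) = L2fun_norm f.
Proof. exact/eq_L2fun_norm/repr_L2class. Qed.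

Lemma L2fun_norm_ge0 f : 0 <= L2fun_norm f.
Proof. by rewrite fine_ge0// Lnorm_ge0. Qed.

Lemma L2fun_norm_fineK (f : L2fun) :
  (L2fun_norm f)%:E = ('N[mu]_2%:E[EFin \o (@normc R \o f)])%E.
Proof.
rewrite fineK// ge0_fin_numE ?Lnorm_ge0//.
by case: (L2funP f).
Qed.

Lemma L2fun_norm_sqr (f : L2fun) :
  ((L2fun_norm f ^+ 2)%:E = \int[mu]_t (normc (f t) ^+ 2)%:E)%E.
Proof.
rewrite -powR_mulrn ?L2fun_norm_ge0// -poweR_EFin L2fun_norm_fineK Lnorm2E.
by apply: eq_integral => t _; rewrite /= ger0_norm ?normc_ge0.
Qed.

Lemma L2fun_normD f g : L2fun_norm (f + g) <= L2fun_norm f + L2fun_norm g.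
Proof.
have mf := measurable_normc (L2funP f).1.
have mg := measurable_normc (L2funP g).1.
have mfg := measurable_normc (L2funP (f + g)).1.
rewrite -lee_fin EFinD !L2fun_norm_fineK.
have p1 : (1 <= 2%:E :> \bar R)%E by rewrite lee_fin ler1n.
apply: le_trans (eminkowski _ mf mg p1).
rewrite unlock; apply: gt0_ler_poweR => //.
- by rewrite in_itv/= leey andbT integral_ge0// => t _; exact: poweR_ge0.
- by rewrite in_itv/= leey andbT integral_ge0// => t _; exact: poweR_ge0.
apply: ge0_le_integral => //.
- by move=> t _; exact: poweR_ge0.
- exact: measurable_abse_poweR.
- by apply: measurable_abse_poweR; exact: measurable_funD.
move=> t _; rewrite /= lee_fin ge0_ler_powR ?nnegrE// !ger0_norm ?normc_ge0//.
  exact: normcD.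
by rewrite addr_ge0 ?normc_ge0.
Qed.

Lemma L2fun_normZ a f : L2fun_norm (a *: f) = normc a * L2fun_norm f.
Proof.
apply/eqP; rewrite -(@eqrXn2 _ 2)//; last 2 first.
- exact: L2fun_norm_ge0.
- by rewrite mulr_ge0 ?normc_ge0 ?L2fun_norm_ge0.
apply/eqP/EFin_inj; rewrite exprMn [RHS]EFinM !L2fun_norm_sqr -ge0_integralZl//.
- by apply: eq_integral => t _; rewrite -EFinM -exprMn -normcM.
- apply/measurable_EFinP; apply: measurable_funX.
  exact: measurable_normc (L2funP f).1.
- by move=> t _; rewrite lee_fin exprn_ge0 ?normc_ge0.
- by rewrite lee_fin exprn_ge0 ?normc_ge0.
Qed.

Lemma L2fun_norm0 f : L2fun_norm f = 0 -> (f : T -> R[i]) = cst 0 %[ae mu].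
Proof.
move=> f0; have := L2fun_norm_fineK f; rewrite f0 => /esym/Lnorm_eq0_eq0.
have mf : measurable_fun setT (EFin \o (@normc R \o f)).
  by apply/measurable_EFinP; exact: measurable_normc (L2funP f).1.
move=> /(_ mf (ltac:(by rewrite lte_fin))); apply: filterS => t /= /(_ I) [].
by move=> /eq0_normc.
Qed.

Let L2Cnorm (x : L2) : R[i] := (L2norm x)%:C.

Lemma L2CnormD x y : L2Cnorm (x + y) <= L2Cnorm x + L2Cnorm y.
Proof.
rewrite -[x]L2class_repr -[y]L2class_repr -L2classD /L2Cnorm !L2normE.
by rewrite -rmorphD lecR L2fun_normD.
Qed.

Lemma L2CnormZ (a : R[i]) x : L2Cnorm (a *: x) = `|a| * L2Cnorm x.
Proof.
rewrite -[x]L2class_repr -L2classZ /L2Cnorm !L2normE L2fun_normZ.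
by rewrite normc_normE -rmorphM.
Qed.

Lemma L2Cnorm0 x : L2Cnorm x = 0 -> x = 0.
Proof.
move=> [] /L2fun_norm0 x0.
rewrite -[x]L2class_repr -[0]L2class_repr; apply/L2classP.
apply: (ae_eq_trans x0); apply: ae_eq_sym.
rewrite -(_ : L2class 0 = 0); last exact: raddf0.
exact: repr_L2class.
Qed.

HB.instance Definition _ := Lmodule_isNormed.Build R[i] L2
  L2CnormD L2CnormZ L2Cnorm0.

End L2fun.

Section complete.
Context d (T : measurableType d) (R : realType) (mu : {measure set T -> \bar R}).
Local Notation q := ((2^-1 : R)).

Lemma sum_half n : \sum_(0 <= k < n) q ^+ k = 2 - 2 * q ^+ n.
Proof.
elim: n => [|n ih]; first by rewrite big_geq// expr0 mulr1 subrr.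
by rewrite big_nat_recr//= ih exprS; field.
Qed.

Lemma cvg_half (u : R^nat) c : (forall n, `|u n.+1 - u n| <= c * q ^+ n) -> cvgn u.
Proof.
move=> uc.
have c0 : 0 <= c by have := le_trans (normr_ge0 _) (uc 0%N); rewrite expr0 mulr1.
have : cvgn (series (telescope u)).
  apply: normed_cvg; apply: (@series_le_cvg _ _ (geometric c q)) => //.
  - by move=> n; exact: normr_ge0.
  - by move=> n; rewrite /geometric /= mulr_ge0// exprn_ge0.
  - by apply: is_cvg_geometric_series; rewrite ger0_norm// invf_lt1// ltr1n.
rewrite telescopeK => h.
have -> : u = (fun n => (u n - u 0%N) + u 0%N).
  by apply/funext => n /=; rewrite subrK.
by apply: is_cvgD; [exact: h|exact: is_cvg_cst].
Qed.

Lemma limn_einf_le (u : (\bar R)^nat) c :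
  (forall n, (u n <= c)%E) -> (limn_einf u <= c)%E.
Proof.
move=> uc; rewrite limn_einf_lim; apply: lime_le; first exact: is_cvg_einfs.
apply: nearW => n; apply: le_trans (uc n); apply: ereal_inf_lbound.
by exists n => //=.
Qed.

Lemma normc_sqr (z : R[i]) : normc z ^+ 2 = complex.Re z ^+ 2 + complex.Im z ^+ 2.
Proof. by case: z => x y /=; rewrite sqr_sqrtr// addr_ge0 ?sqr_ge0. Qed.

Lemma normc_Re (z : R[i]) : `|complex.Re z| <= normc z.
Proof.
rewrite -(@ler_pXn2r _ 2) ?nnegrE ?normc_ge0// normc_sqr real_normK ?num_real//.
by rewrite lerDl sqr_ge0.
Qed.

Lemma normc_Im (z : R[i]) : `|complex.Im z| <= normc z.
Proof.
rewrite -(@ler_pXn2r _ 2) ?nnegrE ?normc_ge0// normc_sqr real_normK ?num_real//.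
by rewrite lerDr sqr_ge0.
Qed.

Lemma ReB (z w : R[i]) : complex.Re (z - w) = complex.Re z - complex.Re w.
Proof. by case: z; case: w. Qed.

Lemma ImB (z w : R[i]) : complex.Im (z - w) = complex.Im z - complex.Im w.
Proof. by case: z; case: w. Qed.

Section fast.
Variable f : nat -> L2fun mu.
Hypothesis ff : forall n, L2fun_norm (f n.+1 - f n) <= (q ^+ n) ^+ 2.

Let S t : \bar R :=
  (\sum_(0 <= k <oo) ((q ^+ k)^-1 ^+ 2 * normc (f k.+1 t - f k t) ^+ 2)%:E)%E.

Let mD (g : L2fun mu) : measurable_fun setT (fun t => (normc (g t) ^+ 2)%:E).
Proof.
by apply/measurable_EFinP/measurable_funX/measurable_normc; exact: (L2funP g).1.
Qed.

Let q0 : 0 < q. Proof. by rewrite invr_gt0. Qed.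

Let q1 : q <= 1. Proof. by rewrite invf_le1// ler1n. Qed.

Let mSk k : measurable_fun setT
  (fun t => ((q ^+ k)^-1 ^+ 2 * normc (f k.+1 t - f k t) ^+ 2)%:E).
Proof.
apply/measurable_EFinP/measurable_funM => //.
by apply/measurable_EFinP; exact: (mD (f k.+1 - f k)).
Qed.

Let Sk0 k t : (0 <= ((q ^+ k)^-1 ^+ 2 * normc (f k.+1 t - f k t) ^+ 2)%:E)%E.
Proof. by rewrite lee_fin mulr_ge0// sqr_ge0. Qed.

Let mS : measurable_fun setT S.
Proof. exact: (@ge0_emeasurable_sum _ _ _ _ _ predT). Qed.

Let S_ge0 t : (0 <= S t)%E.
Proof. by apply: nneseries_ge0 => n _ _; exact: Sk0. Qed.

Let intS : (\int[mu]_t S t <= 2%:E)%E.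
Proof.
rewrite integral_nneseries//.
apply: lime_le.
  by apply: is_cvg_nneseries => n _ _; exact: integral_ge0.
apply: nearW => n; apply: (@le_trans _ _ (\sum_(0 <= k < n) (q ^+ k)%:E)%E).
  apply: lee_sum => k _.
  under eq_integral do rewrite EFinM.
  rewrite ge0_integralZl//; last 2 first.
  - exact: (mD (f k.+1 - f k)).
  - by move=> t _; rewrite lee_fin sqr_ge0.
  rewrite -(L2fun_norm_sqr (f k.+1 - f k)) -EFinM lee_fin.
  have k0 : 0 < q ^+ k by rewrite exprn_gt0.
  rewrite exprVn ler_pdivrMl ?exprn_gt0//.
  apply: (@le_trans _ _ (((q ^+ k) ^+ 2) ^+ 2)).
    by rewrite lerXn2r ?nnegrE ?L2fun_norm_ge0 ?sqr_ge0// ff.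
  have k1 : q ^+ k <= 1 by rewrite exprn_ile1 ?q1// ltW.
  move: (q ^+ k) k0 k1 => z k0 k1; rewrite -exprM -exprSr.
  by rewrite ler_wiXn2l// ltW.
by rewrite sumEFin lee_fin sum_half gerBl mulr_ge0// exprn_ge0// ltW.
Qed.

Let E := [set t | S t \is a fin_num].

Let mE : measurable E.
Proof. by rewrite -[E]setTI; exact: emeasurable_fin_num. Qed.

Let aeE : \forall t \ae mu, E t.
Proof.
have : mu.-integrable setT S.
  apply/integrableP; split => //; under eq_integral do rewrite gee0_abs//.
  exact: le_lt_trans intS (ltry _).
by move=> /(integrable_ae measurableT); apply: filterS => t; exact.
Qed.

Let step t k : E t ->
  normc (f k.+1 t - f k t) <= Num.sqrt (fine (S t)) * q ^+ k.
Proof.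
move=> Et; have k0 : 0 < q ^+ k by rewrite exprn_gt0.
rewrite -(@ler_pXn2r _ 2) ?nnegrE ?normc_ge0 ?mulr_ge0 ?sqrtr_ge0 ?(ltW k0)//.
rewrite exprMn sqr_sqrtr ?fine_ge0//.
rewrite -ler_pdivrMr ?exprn_gt0// mulrC -exprVn -lee_fin fineK//.
have := @nneseries_lim_ge R (fun k => ((q ^+ k)^-1 ^+ 2 * normc (f k.+1 t - f k t) ^+ 2)%:E) predT 0 k.+1
  (fun n _ _ => Sk0 n t).
apply: le_trans; rewrite big_nat_recr//= leeDr//.
by apply: sume_ge0 => i _; exact: Sk0.
Qed.

Let hR n t : R := \1_E t * complex.Re (f n t).
Let hI n t : R := \1_E t * complex.Im (f n t).

Let cvgR t : hR ^~ t @ \oo --> limn (hR ^~ t).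
Proof.
have [Et|Et] := pselect (E t); last first.
  apply/cvg_ex; exists 0; apply: cvg_near_cst; apply: nearW => n.
  by rewrite /hR indicE memNset// mul0r.
apply: (@cvg_half _ (Num.sqrt (fine (S t)))) => n.
rewrite /hR indicE mem_set// !mul1r -ReB.
by apply: le_trans (step n Et); exact: normc_Re.
Qed.

Let cvgI t : hI ^~ t @ \oo --> limn (hI ^~ t).
Proof.
have [Et|Et] := pselect (E t); last first.
  apply/cvg_ex; exists 0; apply: cvg_near_cst; apply: nearW => n.
  by rewrite /hI indicE memNset// mul0r.
apply: (@cvg_half _ (Num.sqrt (fine (S t)))) => n.
rewrite /hI indicE mem_set// !mul1r -ImB.
by apply: le_trans (step n Et); exact: normc_Im.
Qed.

Let g t : R[i] := (limn (hR ^~ t) +i* limn (hI ^~ t))%C.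

Let mg : measurableC g.
Proof.
split; [apply: (@measurable_fun_cvg _ _ _ _ hR)|
        apply: (@measurable_fun_cvg _ _ _ _ hI)].
- by move=> n; apply: measurable_funM => //; exact: (L2funP (f n)).1.1.
- by move=> t _; exact: cvgR.
- by move=> n; apply: measurable_funM => //; exact: (L2funP (f n)).1.2.
- by move=> t _; exact: cvgI.
Qed.

Let fmn n m : L2fun_norm (f (m + n)%N - f n) <= 2 * q ^+ n.
Proof.
suff : L2fun_norm (f (m + n)%N - f n) <= (2 - 2 * q ^+ m) * q ^+ n.
  move=> /le_trans; apply; rewrite ler_pM2r ?exprn_gt0//.
  by rewrite gerBl mulr_ge0// exprn_ge0// ltW.
elim: m => [|m ih].
  rewrite add0n subrr expr0 mulr1 subrr mul0r.
  by rewrite -(scale0r 0) L2fun_normZ normc0 mul0r.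
rewrite addSn -[f _](subrK (f (m + n)%N)) -addrA.
apply: (le_trans (L2fun_normD _ _)).
have m0 : 0 < q ^+ m by rewrite exprn_gt0.
have n0 : 0 < q ^+ n by rewrite exprn_gt0.
have m1 : q ^+ m <= 1 by rewrite exprn_ile1 ?q1// ltW.
have n1 : q ^+ n <= 1 by rewrite exprn_ile1 ?q1// ltW.
apply: (le_trans (lerD (ff (m + n)) ih)).
rewrite exprD (exprS _ m).
have mn : (q ^+ m * q ^+ n) ^+ 2 <= q ^+ m * q ^+ n.
  by rewrite expr2 ger_pMl ?mulr_gt0// mulr_ile1// ltW.
move: mn; move: (q ^+ m) (q ^+ n) => a b.
have -> : (2 - 2 * (q * a)) * b = a * b + (2 - 2 * a) * b by field.
by move=> mn; rewrite lerD2r.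
Qed.

Let gf n : (\int[mu]_t (normc (g t - f n t) ^+ 2)%:E <= ((2 * q ^+ n) ^+ 2)%:E)%E.
Proof.
pose u m t := (\1_E t * normc (f (m + n)%N t - f n t) ^+ 2)%:E.
have mu_ m : measurable_fun setT (u m).
  apply/measurable_EFinP/measurable_funM => //.
  by apply/measurable_EFinP; exact: (mD (f (m + n)%N - f n)).
have u0 m t : (0 <= u m t)%E by rewrite lee_fin mulr_ge0// sqr_ge0.
have ul t : limn_einf (u ^~ t) = (\1_E t * normc (g t - f n t) ^+ 2)%:E.
  apply: (cvg_limn_einf_sup _).1; apply: cvg_EFin; first exact: nearW.
  have [Et|Et] := pselect (E t); last first.
    apply: cvg_near_cst; apply: nearW => m.
    by rewrite /= indicE memNset// !mul0r.
  have E1 : \1_E t = 1 :> R by rewrite indicE mem_set.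
  have uE : (fun m => fine (u m t)) = (fun m =>
      (hR (m + n)%N t - complex.Re (f n t)) ^+ 2 +
      (hI (m + n)%N t - complex.Im (f n t)) ^+ 2).
    by apply/funext => m; rewrite /= normc_sqr ReB ImB /hR /hI E1 !mul1r.
  rewrite (_ : fine \o _ = fun m => fine (u m t))// uE.
  rewrite E1 mul1r normc_sqr ReB ImB.
  have cR : hR (m + n)%N t @[m --> \oo] --> complex.Re (g t).
    by rewrite (cvg_shiftn n (hR ^~ t)); exact: cvgR.
  have cI : hI (m + n)%N t @[m --> \oo] --> complex.Im (g t).
    by rewrite (cvg_shiftn n (hI ^~ t)); exact: cvgI.
  under eq_fun do rewrite !expr2.
  rewrite !expr2.
  have dR : hR (m + n)%N t - complex.Re (f n t) @[m --> \oo] -->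
      complex.Re (g t) - complex.Re (f n t) by apply: cvgB => //; exact: cvg_cst.
  have dI : hI (m + n)%N t - complex.Im (f n t) @[m --> \oo] -->
      complex.Im (g t) - complex.Im (f n t) by apply: cvgB => //; exact: cvg_cst.
  by apply: cvgD; apply: cvgM.
have -> : (\int[mu]_t (normc (g t - f n t) ^+ 2)%:E =
           \int[mu]_t limn_einf (u ^~ t))%E.
  under [RHS]eq_integral do rewrite ul.
  have m1 : measurable_fun setT (fun t => normc (g t - f n t) ^+ 2).
    apply: measurable_funX.
    have -> : (fun t => normc (g t - f n t)) =
        @normc R \o (-1 *: (f n : T -> R[i]) + g).
      by apply/funext => t; rewrite /= addrC -scaleN1r.
    exact/measurable_normc/measurableC_lin/mg/(L2funP (f n)).1.
  apply: ge0_ae_eq_integral => //.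
  - exact/measurable_EFinP.
  - by apply/measurable_EFinP/measurable_funM.
  - by move=> t _; rewrite lee_fin sqr_ge0.
  - by move=> t _; rewrite lee_fin mulr_ge0// sqr_ge0.
  by move: aeE; apply: filterS => t Et _; rewrite indicE mem_set// mul1r.
apply: (le_trans (fatou _ measurableT mu_ (fun m t _ => u0 m t))).
apply: limn_einf_le => m.
apply: (@le_trans _ _ (\int[mu]_t (normc ((f (m + n)%N - f n) t) ^+ 2)%:E)%E).
  apply: ge0_le_integral => //.
  by move=> t _; rewrite lee_fin ler_piMl ?sqr_ge0// indicE; case: (t \in E).
by rewrite -L2fun_norm_sqr lee_fin lerXn2r ?nnegrE ?L2fun_norm_ge0.
Qed.

Lemma L2fun_complete : exists g : L2fun mu,
  forall n, L2fun_norm (g - f n) <= 2 * q ^+ n.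
Proof.
have g2 : g \in square_integrable mu.
  have -> : g = (g - f 0%N) + f 0%N by rewrite subrK.
  have fL : (f 0%N : T -> R[i]) \in square_integrable mu by case: (f 0%N).
  apply: rpredD => //; apply/square_integrableP; split.
    rewrite -scaleN1r addrC; apply: measurableC_lin mg.
    exact: (L2funP (f 0%N)).1.
  apply/finite_norm2P; apply: (le_lt_trans _ (ltry ((2 * q ^+ 0) ^+ 2))).
  apply: le_trans (gf 0).
  by under eq_integral do rewrite /= ger0_norm ?normc_ge0//.
exists (L2Fun g2) => n.
rewrite -(@ler_pXn2r _ 2) ?nnegrE ?L2fun_norm_ge0//.
by rewrite -lee_fin L2fun_norm_sqr; exact: gf.
Qed.

End fast.

Lemma normr_L2class (f : L2fun mu) : `|L2class f| = (L2fun_norm f)%:C.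
Proof. by rewrite -L2normE. Qed.

Lemma L2classB (f g : L2fun mu) : L2class (f - g) = L2class f - L2class g.
Proof. exact: raddfB. Qed.

Lemma L2_complete (F : set_system (L2 mu)) : ProperFilter F -> cauchy F -> cvg F.
Proof.
move=> FF /cauchyP Fc.
have q0 n : 0 < (q ^+ n.+2) ^+ 2 by rewrite !exprn_gt0// invr_gt0.
have /choice[x Fx] n : exists x, F (ball x (((q ^+ n.+2) ^+ 2)%:C : R[i])).
  by apply: Fc; rewrite ltcR.
pose f n := repr (x n).
have fE n : L2class (f n) = x n by exact: L2class_repr.
have xball n y : ball (x n) (((q ^+ n.+2) ^+ 2)%:C : R[i]) y ->
    L2fun_norm (f n - repr y) < (q ^+ n.+2) ^+ 2.
  rewrite -ball_normE /= -ltcR -normr_L2class L2classB fE.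
  by rewrite L2class_repr.
have [g gf] : exists g : L2fun mu, forall n, L2fun_norm (g - f n) <= 2 * q ^+ n.
  apply: L2fun_complete => n.
  have [y [/xball y1 /xball y2]] := filter_ex (filterI (Fx n) (Fx n.+1)).
  have -> : f n.+1 - f n = (f n.+1 - repr y) + (-1) *: (f n - repr y).
    by rewrite scaleN1r opprB addrA subrK.
  apply: (le_trans (L2fun_normD _ _)); rewrite L2fun_normZ.
  rewrite normcN normc1 mul1r; move: y1 y2; rewrite !exprS.
  move: (q ^+ n) => z; rewrite expr0; have := sqr_ge0 z.
  by nra.
apply/cvg_ex; exists (L2class g).
apply/fcvg_ballP => -[e e'] e0.
have e'0 : e' = 0.
  by apply/eqP; move: e0; rewrite ltcE /= => /andP[].
subst e'; have {}e0 : 0 < e by move: e0; rewrite ltcR.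
have [n ne] : exists n, 3 * q ^+ n < e.
  have : geometric 3 q x @[x --> \oo] --> (0 : R).
    by apply: cvg_geometric; rewrite ger0_norm// invf_lt1// ltr1n.
  move=> /cvgrPdist_lt/(_ _ e0)[N _ /(_ N)] /= h; exists N.
  by apply: (le_lt_trans (ler_norm _)); rewrite -normrN -sub0r h.
apply: filterS (Fx n) => y /xball yn.
rewrite -ball_normE /= -[y]L2class_repr -L2classB normr_L2class ltcR.
apply: le_lt_trans ne.
rewrite -[g](subrK (f n)) -addrA (le_trans (L2fun_normD _ _))//.
have {}yn := ltW yn.
apply: (le_trans (lerD (gf n) yn)).
have z0 : 0 <= q ^+ n by rewrite exprn_ge0.
have z1 : q ^+ n <= 1 by rewrite exprn_ile1// invf_le1// ler1n.
rewrite !exprS; move: (q ^+ n) z0 z1 => z z0 z1; rewrite expr0.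
by nra.
Qed.

HB.instance Definition _ := Uniform_isComplete.Build (L2 mu) L2_complete.

End complete.

Section generalized_hyperbolic.
Context {R : realType} {X : completeNormedModType R[i]}.
Implicit Types (M N : set X) (S T U : X -> X).

Definition closed_linear_subspace M : Prop :=
  [/\ closed M, M 0 & forall (a : R[i]) x y, M x -> M y -> M (a *: x + y)].

Definition direct_sum_decomposition M N : Prop :=
  M `&` N = [set 0] /\ forall x, exists m n, [/\ M m, N n & x = m + n].

(* The bounded linear operators M -> M, for a linear subspace M of X, are
   encoded as functions X -> X whose values outside M are irrelevant. *)
Definition bounded_operator_on M S : Prop :=
  [/\ forall x, M x -> M (S x),
      forall (a : R[i]) x y, M x -> M y -> S (a *: x + y) = a *: S x + S y &
      exists C : R, forall x, M x -> `|S x| <= C%:C * `|x| ].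

Definition spectrum_on M S : set R[i] :=
  [set z | ~ exists2 U, bounded_operator_on M U &
     forall x, M x ->
       U (z *: x - S x) = x /\ z *: U x - S (U x) = x].

(* The maximum with 0 only matters for M = 0, where the spectrum is empty. *)
Definition spectral_radius_on M S : \bar R :=
  maxe 0%E (ereal_sup [set (normc z)%:E | z in spectrum_on M S]).

(* pinv N T is the inverse T @` N -> N of T restricted to N. *)
Definition generalized_hyperbolic T : Prop :=
  bounded_operator_on setT T /\
  exists M N,
    [/\ closed_linear_subspace M /\ closed_linear_subspace N,
        direct_sum_decomposition M N,
        T @` M `<=` M /\ (spectral_radius_on M T < 1)%E &
        [/\ set_bij N (T @` N) T, closed (T @` N), N `<=` T @` N &
            (spectral_radius_on N (pinv N T) < 1)%E]].

End generalized_hyperbolic.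

Section dilation.
Context (R : realType).

(* L^2(]0, +oo[, dt) is encoded as L2 lebesgue_Rplus: its elements are
   represented by functions on R, and lebesgue_Rplus-a.e. equality ignores
   their values on ]-oo, 0]. *)
Definition lebesgue_Rplus : {measure set (measurableTypeR R) -> \bar R} :=
  mrestr (@lebesgue_measure R) (measurable_itv `]0%R, +oo[).

Lemma measurable_dilation (a : R) :
  measurable_fun [set: measurableTypeR R] ( *%R a : measurableTypeR R -> measurableTypeR R).
Proof. exact: mulrl_measurable. Qed.

Lemma lebesgue_measure_dilation (a : R) (A : set (measurableTypeR R)) :
  0 < a -> measurable A ->
  lebesgue_measure ( *%R a @^-1` A) = ((a^-1)%:E * lebesgue_measure A)%E.
Proof.
move=> a0 mA.
pose m' : {measure set (measurableTypeR R) -> \bar R} :=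
  mscale (NngNum (ltW a0))
    (measure_function.pushforward (@lebesgue_measure R) ( *%R a : _ -> measurableTypeR R)).
pose m := m' (measurable_dilation a).
have mE X : m X = (a%:E * lebesgue_measure ( *%R a @^-1` X))%E by [].
have -> : lebesgue_measure A = m A.
  apply: lebesgue_measure_unique => // X [[x y] _ <-]; rewrite mE.
  rewrite (_ : _ @^-1` _ = `]a^-1 * x, a^-1 * y]%classic); last first.
    by apply/seteqP; split => t /=; rewrite !in_itv/= ltr_pdivrMl// ler_pdivlMl.
  rewrite !lebesgue_measure_itv/= !lte_fin ltr_pM2l ?invr_gt0//.
  case: ifPn => _; last by rewrite mule0.
  by rewrite -!EFinB -EFinM -mulrBr mulrA divff ?gt_eqF// mul1r.
by rewrite mE muleA -EFinM mulVf ?gt_eqF// mul1e.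
Qed.

Lemma lebesgue_Rplus_dilation (a : R) (A : set (measurableTypeR R)) :
  0 < a -> measurable A ->
  lebesgue_Rplus ( *%R a @^-1` A) = ((a^-1)%:E * lebesgue_Rplus A)%E.
Proof.
move=> a0 mA; rewrite /lebesgue_Rplus /= /mrestr.
rewrite -lebesgue_measure_dilation//; last exact: measurableI.
congr lebesgue_measure; apply/seteqP; split => t /=;
  by rewrite !in_itv/= !andbT pmulr_rgt0.
Qed.

Lemma ge0_integral_dilation (a : R) (f : measurableTypeR R -> \bar R) :
  0 < a -> measurable_fun setT f -> (forall t, 0 <= f t)%E ->
  (\int[lebesgue_Rplus]_t f (a * t)%R =
   (a^-1)%:E * \int[lebesgue_Rplus]_t f t)%E.
Proof.
move=> a0 mf f0.
have a1 : 0 <= a^-1 by rewrite invr_ge0 ltW.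
have := @ge0_integral_pushforward _ _ _ _ R _ (measurable_dilation a)
  lebesgue_Rplus setT f measurableT mf (fun t _ => f0 t).
rewrite preimage_setT => <-.
rewrite -(@ge0_integral_mscale _ _ _ _ _ measurableT (NngNum a1))//.
by apply: eq_measure_integral => A mA _ /=; exact: lebesgue_Rplus_dilation.
Qed.

Lemma ae_Rplus : \forall t \ae lebesgue_Rplus, 0 < t.
Proof.
exists `]-oo, 0%R]%classic; split; first exact: measurable_itv.
  rewrite /lebesgue_Rplus /= /mrestr (_ : _ `&` _ = set0) ?measure0//.
  apply/seteqP; split => t //=; rewrite !in_itv/= andbT => -[t0].
  by rewrite ltNge t0.
by move=> t /=; rewrite in_itv/= leNgt => /negP.
Qed.

Lemma ae_dilation (a : R) (P : R -> Prop) : 0 < a ->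
  (\forall t \ae lebesgue_Rplus, P t) ->
  \forall t \ae lebesgue_Rplus, P (a * t).
Proof.
move=> a0 [N [mN N0 PN]]; exists ( *%R a @^-1` N); split.
- by rewrite -[X in measurable X]setTI; exact: measurable_dilation.
- by rewrite lebesgue_Rplus_dilation// N0 mule0.
- by move=> t /= Pt; exact: PN.
Qed.

Definition Wfun (a : R) (f : R -> R[i]) : R -> R[i] :=
  fun t => (expR (- (t * (1 - a))))%:C * f (a * t).

Lemma Wfun_L2 (a : R) (f : L2fun lebesgue_Rplus) : 0 < a < 1 ->
  Wfun a f \in square_integrable lebesgue_Rplus.
Proof.
move=> /andP[a0 a1]; have [[mr mi] ff] := L2funP f.
have me : measurable_fun [set: measurableTypeR R] (fun t => expR (- (t * (1 - a)))).
  apply: measurableT_comp => //; apply: measurable_funN.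
  exact: mulrr_measurable.
have mda (h : measurableTypeR R -> R) :
    measurable_fun setT h -> measurable_fun setT (fun t => h (a * t)).
  by move=> mh; apply: measurableT_comp mh _; exact: measurable_dilation.
have mW : measurableC (Wfun a f : measurableTypeR R -> R[i]).
  split.
    rewrite (_ : _ \o _ =
        (fun t => expR (- (t * (1 - a))) * (@complex.Re R \o f) (a * t))).
      by apply: measurable_funM => //; exact: mda.
    by apply/funext => t; rewrite /Wfun /= ReM /= mul0r subr0.
  rewrite (_ : _ \o _ =
      (fun t => expR (- (t * (1 - a))) * (@complex.Im R \o f) (a * t))).
    by apply: measurable_funM => //; exact: mda.
  by apply/funext => t; rewrite /Wfun /= ImM /= mul0r addr0.
apply/square_integrableP; split=> //; apply/finite_norm2P.
have mf2 : measurable_fun [set: measurableTypeR R] (fun t => (normc (f t) ^+ 2)%:E).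
  by apply/measurable_EFinP/measurable_funX/measurable_normc; split.
apply: (@le_lt_trans _ _ (\int[lebesgue_Rplus]_t (normc (f (a * t)) ^+ 2)%:E)%E).
  apply: ae_ge0_le_integral => //.
  - apply/measurable_EFinP; apply: measurable_funX; apply: measurableT_comp => //.
    exact: measurable_normc.
  - by move=> t _; rewrite lee_fin exprn_ge0 ?normc_ge0.
  - apply: (measurableT_comp mf2); exact: measurable_dilation.
  have := ae_Rplus.
  apply: (@filterS _ _ (ae_filter_ringOfSetsType lebesgue_Rplus)) => t t0 _.
  rewrite lee_fin lerXn2r ?nnegrE ?normc_ge0//= ger0_norm ?normc_ge0//.
  rewrite /Wfun normcM normc_real ger0_norm ?expR_ge0// ler_piMl ?normc_ge0//.
  by rewrite expR_le1 oppr_le0 mulr_ge0 ?subr_ge0 // ltW.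
rewrite (@ge0_integral_dilation a (fun t => (normc (f t) ^+ 2)%:E))//; last first.
  by move=> t; rewrite lee_fin exprn_ge0 ?normc_ge0.
rewrite -L2fun_norm_sqr -EFinM; exact: ltry.
Qed.

(* W does not depend on the representative chosen: see W_L2class. *)
Definition W (a : R) (a01 : 0 < a < 1) (F : L2 lebesgue_Rplus) : L2 lebesgue_Rplus :=
  L2class (L2Fun (Wfun_L2 (repr F) a01)).

Lemma W_L2class (a : R) (a01 : 0 < a < 1) (f : L2fun lebesgue_Rplus) :
  W a01 (L2class f) = L2class (L2Fun (Wfun_L2 f a01)).
Proof.
apply/L2classP; have /andP[a0 _] := a01.
have /(ae_dilation a0) := repr_L2class f.
apply: (@filterS _ _ (ae_filter_ringOfSetsType lebesgue_Rplus)) => t /= /(_ I).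
by move=> ft _; rewrite /Wfun ft.
Qed.

End dilation.

(* Main.v *)
Require Import Defs.
From mathcomp Require Import all_boot all_order all_algebra complex.
From mathcomp Require Import all_classical all_reals all_analysis.
From mathcomp Require Import measurable_realfun ring lra.
Set Implicit Arguments.
Unset Strict Implicit.
Unset Printing Implicit Defensive.
Import Order.TTheory GRing.Theory Num.Theory.
Import numFieldNormedType.Exports ComplexField.Normc.
Local Open Scope classical_set_scope.
Local Open Scope complex_scope.
Local Open Scope ring_scope.

(** Cut the half-line at a point c > 0 and let M, N be the functions
supported in ]c, +oo[ and in ]0, c]. Since W F(t) = e^(-t(1-a)) F(at) moves
supports outwards by the factor 1/a > 1, W maps M into M and maps N onto the
functions supported in ]0, c/a], a closed subspace that contains N. On N the
inverse is again a weighted dilation, y |-> e^(t(1-a)/a) y(t/a), and it moves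
supports inwards.

A weighted dilation x |-> w(t) x(bt) multiplies the norm by at most
sup |w| / sqrt b, the supremum being over the t for which bt meets the support
of x ([weighted_dilation_le]). With d = c(1-a) this gives
  |W x| <= e^(-d/a) / sqrt a |x|  on M  (there t > c/a), and
  |W^-1 y| <= e^d sqrt a |y|      on N  (there t <= ac).
Put L = - ln (sqrt a) > 0. Both constants are below 1 exactly when
a L < d < L, an interval that is nonempty because a < 1 ([cut_exists]). With
such a c both restrictions are strict contractions, and a contraction with
constant rho has spectral radius at most rho ([spectral_radius_on_le]). The
choice of c thus reduces each spectral radius to one norm estimate. *)

(** * Spectral radius of a contraction on a closed subspace *)

Section spectral_radius.
Context {R : realType} {X : completeNormedModType R[i]}.
Implicit Types (x y : X) (M : set X) (S T U : X -> X) (rho k : R).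

(** Norms take values in the ordered but not totally ordered field R[i]; their
real parts allow arithmetic in R. *)
Definition nrm x : R := complex.Re `|x|.

Lemma nrmE x : `|x| = (nrm x)%:C.
Proof.
rewrite /nrm; have := normr_ge0 x; case: `|x| => p q.
by rewrite lecE /= => /andP[/eqP->].
Qed.

Lemma nrm_ge0 x : 0 <= nrm x.
Proof. by rewrite -lecR -nrmE; exact: normr_ge0. Qed.

Lemma nrmD x y : nrm (x + y) <= nrm x + nrm y.
Proof. by rewrite -lecR rmorphD /= -!nrmE Num.Theory.ler_normD. Qed.

Lemma nrmZ (z : R[i]) x : nrm (z *: x) = normc z * nrm x.
Proof.
by apply: (fmorph_inj (real_complex R)); rewrite rmorphM /= -!nrmE normrZ normc_normE.
Qed.

Lemma nrmN x : nrm (- x) = nrm x.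
Proof. by rewrite /nrm normrN. Qed.

Lemma nrm_le0 x : nrm x <= 0 -> x = 0.
Proof.
move=> x0; apply/eqP; rewrite -normr_eq0 nrmE.
by rewrite (_ : nrm x = 0)//; apply/eqP; rewrite eq_le x0 nrm_ge0.
Qed.

Lemma near_nrm x (e : R) : 0 < e -> \forall y \near x, nrm (x - y) < e.
Proof.
move=> e0; have e0' : (0 : R[i]) < e%:C by rewrite ltcR.
have := nbhsx_ballx x e%:C e0'; rewrite -ball_normE; apply: filterS => y /=.
by rewrite nrmE ltcR.
Qed.

Lemma geometric_le0 k (c d : R) :
  0 <= k < 1 -> (forall n, c <= d * k ^+ n) -> c <= 0.
Proof.
move=> /andP[k0 k1] h; rewrite leNgt; apply/negP => c0.
have : geometric d k n @[n --> \oo] --> (0 : R).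
  by apply: cvg_geometric; rewrite ger0_norm.
move=> /cvgrPdist_lt/(_ _ c0)[n _ /(_ n (leqnn n))].
rewrite sub0r normrN => dc.
by have := lt_le_trans dc (h n); rewrite ltNge ler_norm.
Qed.

(** Telescoping bounds |u (n + m) - u n| by the tail of the geometric series,
which gives both the Cauchy property and the rate of convergence. *)
Lemma geometric_cvg k (c : R) (u : nat -> X) : 0 <= k < 1 ->
  (forall n, nrm (u n.+1 - u n) <= c * k ^+ n) ->
  exists2 l, u n @[n --> \oo] --> l &
    forall n, nrm (l - u n) <= c / (1 - k) * k ^+ n.
Proof.
move=> /andP[k0 k1] uc; set d := c / (1 - k).
have cd : c = d * (1 - k) by rewrite /d divfK// subr_eq0 gt_eqF.
have k1' : 0 < 1 - k by rewrite subr_gt0.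
have c0 : 0 <= c by have := le_trans (nrm_ge0 _) (uc 0%N); rewrite expr0 mulr1.
have d0 : 0 <= d by rewrite divr_ge0// ltW.
have uD n m : nrm (u (n + m)%N - u n) <= d * k ^+ n * (1 - k ^+ m).
  elim: m => [|m ih].
    by rewrite addn0 subrr expr0 subrr mulr0 /nrm normr0.
  have -> : u (n + m.+1)%N - u n =
      (u (n + m).+1 - u (n + m)%N) + (u (n + m)%N - u n).
    by rewrite addnS addrA subrK.
  apply: (le_trans (nrmD _ _)); apply: (le_trans (lerD (uc _) ih)).
  by rewrite cd exprD exprS le_eqVlt; apply/orP; left; apply/eqP; ring.
have uD' n m : (n <= m)%N -> nrm (u m - u n) <= d * k ^+ n.
  move=> /subnKC <-; apply: (le_trans (uD _ _)).
  apply: ler_piMr; first by rewrite mulr_ge0 ?exprn_ge0.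
  by rewrite gerBl exprn_ge0.
have cu : cvgn u.
  apply: cauchy_cvg; apply: cauchy_exP => -[e e'] e0.
  have /eqP e'0 : e' == 0 by move: e0; rewrite ltcE /= => /andP[].
  subst e'; have {}e0 : 0 < e by move: e0; rewrite ltcR.
  have [n ne] : exists n, d * k ^+ n < e.
    apply: contrapT => h; have : e <= 0; last by rewrite leNgt e0.
    apply: (@geometric_le0 k e d); first by rewrite k0.
    by move=> n; rewrite leNgt; apply/negP => ?; apply: h; exists n.
  exists (u n); exists n => // m /= nm.
  by rewrite -ball_normE /= -normrN opprB nrmE ltcR (le_lt_trans (uD' _ _ nm)).
exists (limn u) => // n.
apply/ler_addgt0Pl => e e0.
have /cu [m _ hm] := near_nrm (limn u) e0.
have := hm _ (leq_maxl m n) => /= h.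
rewrite -[limn u](subrK (u (maxn m n))) -addrA.
apply: (le_trans (nrmD _ _)); apply: lerD; first exact: ltW.
by rewrite uD'// leq_maxr.
Qed.

Section resolvent.
Variables (M : set X) (S : X -> X) (rho : R) (z : R[i]).
Hypothesis M_subspace : closed_linear_subspace M.
Hypothesis S_bounded : bounded_operator_on M S.
Hypothesis S_le : forall x, M x -> nrm (S x) <= rho * nrm x.
Hypothesis rho0 : 0 <= rho.
Hypothesis rho_z : rho < normc z.

Let z_neq0 : z != 0.
Proof. by apply: contraTneq rho_z => ->; rewrite normc0 -leNgt. Qed.

Let MD x y : M x -> M y -> M (x + y).
Proof. by move: M_subspace => [_ _ h] ? ?; rewrite -[x]scale1r; exact: h. Qed.

Let MZ (c : R[i]) x : M x -> M (c *: x).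
Proof. by move: M_subspace => [_ M0 h] ?; rewrite -[_ *: _]addr0; exact: h. Qed.

Let MB x y : M x -> M y -> M (x - y).
Proof. by move=> ? ?; apply: MD => //; rewrite -scaleN1r; exact: MZ. Qed.

Let MS x : M x -> M (S x).
Proof. by move: S_bounded => [h _ _]; exact: h. Qed.

Let SB x y : M x -> M y -> S (x - y) = S x - S y.
Proof.
move: S_bounded => [_ h _] Mx My.
by rewrite addrC -scaleN1r h// scaleN1r addrC.
Qed.

(** As |S x| <= rho |x|, the operator z - S is bounded below by |z| - rho > 0:
this yields its injectivity and the boundedness of its inverse. *)
Lemma resolvent_le x : M x ->
  (normc z - rho) * nrm x <= nrm (z *: x - S x).
Proof.
move=> Mx; rewrite mulrBl lerBlDr -nrmZ.
rewrite -{1}[z *: x](subrK (S x)); apply: (le_trans (nrmD _ _)).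
by rewrite lerD2l S_le.
Qed.

Lemma resolvent_inj x y : M x -> M y -> z *: x - S x = z *: y - S y -> x = y.
Proof.
move=> Mx My e; apply/eqP; rewrite -subr_eq0; apply/eqP/nrm_le0.
have := resolvent_le (MB Mx My).
have -> : z *: (x - y) - S (x - y) = (z *: x - S x) - (z *: y - S y).
  by rewrite SB// scalerBr !opprD !opprK addrACA.
by rewrite e subrr /nrm normr0 pmulr_rle0// subr_gt0.
Qed.

(** The equation z x - S x = y says that x is a fixed point of the map
x |-> z^-1 (y + S x), which contracts M with factor rho / |z|. The iterates
from 0 are the partial sums of the Neumann series; they converge in M since M
is closed. *)
Lemma resolvent_surj y : M y -> exists2 x, M x & z *: x - S x = y.
Proof.
move=> My; pose f x := z^-1 *: (y + S x); pose u n := iter n f 0.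
have M0 : M 0 by case: M_subspace.
have Mu n : M (u n).
  by elim: n => //= n ih; apply: MZ; apply: MD => //; exact: MS.
pose k := rho / normc z.
have nz0 : 0 < normc z by exact: le_lt_trans rho_z.
have k01 : 0 <= k < 1.
  by rewrite /k divr_ge0 ?normc_ge0//= ltr_pdivrMr// mul1r.
have uc n : nrm (u n.+1 - u n) <= nrm (u 1%N) * k ^+ n.
  elim: n => [|n ih]; first by rewrite subr0 expr0 mulr1.
  have -> : u n.+2 - u n.+1 = z^-1 *: S (u n.+1 - u n).
    by rewrite SB// /u /= /f -scalerBr opprD addrACA subrr add0r.
  rewrite nrmZ normcV exprS mulrCA.
  have := S_le (MB (Mu n.+1) (Mu n)) => h.
  rewrite ler_pdivrMl//; apply: (le_trans h).
  have {1}-> : rho = normc z * k by rewrite /k mulrC divfK// gt_eqF.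
  rewrite -mulrA.
  by apply: ler_wpM2l => //; [exact: ltW|]; case/andP: k01 => k0 _; exact: ler_wpM2l.
have [x ux xu] := geometric_cvg k01 uc.
have Mx : M x.
  by move: M_subspace => [cM _ _]; apply: (closed_cvg _ cM _ _ ux); exact: nearW.
exists x => //; apply/eqP; rewrite -subr_eq0; apply/eqP/nrm_le0.
set d := nrm _ / _ in xu.
(* The defect of the limit is bounded by the errors of two consecutive
   iterates, as z (u n.+1) = y + S (u n). *)
apply: (@geometric_le0 k _ (normc z * d * k + rho * d)) => // n.
have -> : z *: x - S x - y = z *: (x - u n.+1) - S (x - u n).
  rewrite SB//= /f scalerBr scalerA divff// scale1r.
  by rewrite !opprD !opprK !addrA [_ - S x + S (u n)]addrAC subrK addrAC.
apply: (le_trans (nrmD _ _)); rewrite nrmN nrmZ.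
have h1 := ler_wpM2l (normc_ge0 z) (xu n.+1).
have h2 := le_trans (S_le (MB Mx (Mu n))) (ler_wpM2l rho0 (xu n)).
by apply: (le_trans (lerD h1 h2)); rewrite exprS le_eqVlt; apply/orP; left;
  apply/eqP; ring.
Qed.

End resolvent.

(** Every z with |z| > rho is in the resolvent set: z - S is bijective on M and
bounded below there. *)
Lemma spectral_radius_on_le M S rho : closed_linear_subspace M ->
  bounded_operator_on M S -> 0 <= rho ->
  (forall x, M x -> nrm (S x) <= rho * nrm x) ->
  (spectral_radius_on M S <= rho%:E)%E.
Proof.
move=> Msub Sb rho0 S_le; rewrite /spectral_radius_on ge_max lee_fin rho0 /=.
apply: ge_ereal_sup => _ [z zs <-]; rewrite lee_fin leNgt.
apply/negP => rz; apply: zs.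
pose P y x := M y -> M x /\ z *: x - S x = y.
have /choice[U PU] y : exists x, P y x.
  have [My|My] := pselect (M y); last by exists 0.
  by have [x Mx xy] := resolvent_surj Msub Sb S_le rho0 rz My; exists x.
have MU y : M y -> M (U y) by move=> /PU[].
have UE y : M y -> z *: U y - S (U y) = y by move=> /PU[].
have [cM M0 Ml] := Msub; have [MS Sl SC] := Sb.
have MR x : M x -> M (z *: x - S x).
  by move=> Mx; rewrite addrC -scaleN1r; apply: (Ml); [exact: MS|];
    rewrite -[_ *: _]addr0; exact: Ml.
exists U; last first.
  move=> x Mx; split; last exact: UE.
  by apply: (resolvent_inj Msub Sb S_le rz);
    [exact/MU/MR|exact: Mx|exact/UE/MR].
split=> //.
  move=> c x y Mx My; apply: (resolvent_inj Msub Sb S_le rz).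
  - by apply: MU; exact: Ml.
  - by apply: Ml; exact: MU.
  rewrite UE; last exact: Ml.
  rewrite Sl; [|exact: MU|exact: MU].
  rewrite -{1}[x]UE// -{1}[y]UE// !scalerDr scalerN !scalerA [z * c]mulrC.
  by rewrite opprD addrACA.
exists (normc z - rho)^-1 => y My.
rewrite !nrmE -rmorphM lecR ler_pdivlMl ?subr_gt0//.
by rewrite (le_trans (resolvent_le z S_le (MU _ My)))// UE.
Qed.

End spectral_radius.

(** * Weighted dilations of the half-line *)

Section weighted_dilation.
Variable R : realType.
Local Notation mu := (@lebesgue_Rplus R).
Implicit Types (w v : R -> R) (A B : set (measurableTypeR R)) (x y : L2 mu).
Implicit Types (T S : L2 mu -> L2 mu).

Let ae_filter := ae_filter_ringOfSetsType mu.
Local Existing Instance ae_filter.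

Lemma reprD_ae (k : R[i]) x y :
  \forall t \ae mu, repr (k *: x + y) t = k * repr x t + repr y t.
Proof.
have := repr_L2class (k *: repr x + repr y).
by rewrite L2classD L2classZ !L2class_repr; apply: filterS => t /= /(_ I).
Qed.

Lemma repr_ae_inj x y : (\forall t \ae mu, repr x t = repr y t) -> x = y.
Proof.
move=> xy; rewrite -[x]L2class_repr -[y]L2class_repr; apply/L2classP.
by apply: filterS xy => t /= ->.
Qed.

Lemma repr0_ae : \forall t \ae mu, repr (0 : L2 mu) t = 0.
Proof.
by have := reprD_ae (-1) 0 0; rewrite scaler0 addr0; apply: filterS => t ->;
  rewrite mulN1r addNr.
Qed.

Lemma nrm_L2 x : nrm x = L2fun_norm (repr x).
Proof. by rewrite /nrm -{1}[x]L2class_repr normr_L2class. Qed.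

Definition weighted_dilation w (b : R) (f : R -> R[i]) : R -> R[i] :=
  fun t => (w t)%:C * f (b * t).

Lemma measurableC_weighted_dilation w b (f : measurableTypeR R -> R[i]) :
  measurable_fun [set: measurableTypeR R] (w : measurableTypeR R -> R) ->
  Defs.measurableC f ->
  Defs.measurableC (weighted_dilation w b f : measurableTypeR R -> R[i]).
Proof.
move=> mw [mr mi].
have mda (h : measurableTypeR R -> R) :
    measurable_fun setT h -> measurable_fun setT (fun t => h (b * t)).
  by move=> mh; apply: measurableT_comp mh _; exact: measurable_dilation.
split.
  rewrite (_ : _ \o _ = (fun t => w t * (@complex.Re R \o f) (b * t))).
    by apply: measurable_funM => //; exact: mda.
  by apply/funext => t; rewrite /weighted_dilation /= Defs.ReM /= mul0r subr0.
rewrite (_ : _ \o _ = (fun t => w t * (@complex.Im R \o f) (b * t))).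
  by apply: measurable_funM => //; exact: mda.
by apply/funext => t; rewrite /weighted_dilation /= Defs.ImM /= mul0r addr0.
Qed.

(** The substitution s = bt contributes the factor 1/b. *)
Lemma integral_dilation_le (b K : R) (f g : measurableTypeR R -> R[i]) :
  0 < b -> 0 <= K -> Defs.measurableC f -> Defs.measurableC g ->
  (\forall t \ae mu, normc (g t) <= K * normc (f (b * t))) ->
  (\int[mu]_t (normc (g t) ^+ 2)%:E <=
   (K ^+ 2 / b)%:E * \int[mu]_t (normc (f t) ^+ 2)%:E)%E.
Proof.
move=> b0 K0 mf mg fg.
have m2 (h : measurableTypeR R -> R[i]) : Defs.measurableC h ->
    measurable_fun setT (fun t => (normc (h t) ^+ 2)%:E).
  by move=> mh; apply/measurable_EFinP/measurable_funX/measurable_normc.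
have n2 (h : measurableTypeR R -> R[i]) t : (0 <= (normc (h t) ^+ 2)%:E)%E.
  by rewrite lee_fin exprn_ge0 ?normc_ge0.
have mfb : measurable_fun setT (fun t : measurableTypeR R => (normc (f (b * t)) ^+ 2)%:E).
  by apply: (measurableT_comp (m2 _ mf)); exact: measurable_dilation.
rewrite EFinM -muleA -(@ge0_integral_dilation _ b (fun t => (normc (f t) ^+ 2)%:E) b0 (m2 _ mf) (n2 f)).
rewrite -ge0_integralZl//; last by rewrite lee_fin exprn_ge0.
apply: ae_ge0_le_integral => //.
- exact: m2.
- by move=> t _; rewrite mule_ge0// lee_fin exprn_ge0// normc_ge0.
- by apply: measurable_funeM; exact: mfb.
apply: filterS fg => t fgt _.
rewrite -EFinM lee_fin -exprMn lerXn2r ?nnegrE ?normc_ge0//.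
by rewrite mulr_ge0// normc_ge0.
Qed.

(** The weight is bounded on the half-line only, as t <= 0 is a null set: for
the operator W it is unbounded on R. *)
Lemma weighted_dilation_L2 w (b K : R) (f : L2fun mu) :
  0 < b -> measurable_fun [set: measurableTypeR R] (w : measurableTypeR R -> R) ->
  (forall t, 0 < t -> `|w t| <= K) ->
  weighted_dilation w b f \in square_integrable mu.
Proof.
move=> b0 mw wK; have [mf ff] := L2funP f.
have mg := measurableC_weighted_dilation b mw mf.
apply/square_integrableP; split => //; apply/finite_norm2P.
have K0 : 0 <= K by exact: le_trans (wK 1 ltr01).
under eq_integral do rewrite /= ger0_norm ?normc_ge0//.
apply: le_lt_trans (integral_dilation_le b0 K0 mf mg _) _.
  apply: filterS (ae_Rplus R) => t t0.
  by rewrite normcM normc_real ler_wpM2r ?normc_ge0// wK.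
by rewrite -L2fun_norm_sqr -EFinM; exact: ltry.
Qed.

(** Stated for an operator, so that W, its inverse on N, and the restrictions to
measurable sets (b = 1 and w an indicator) are covered by the same lemmas. *)
Definition is_weighted_dilation w b T := forall x,
  \forall t \ae mu, repr (T x) t = weighted_dilation w b (repr x) t.

Lemma weighted_dilation_exists w (b K : R) :
  0 < b -> measurable_fun [set: measurableTypeR R] (w : measurableTypeR R -> R) ->
  (forall t, 0 < t -> `|w t| <= K) -> exists T, is_weighted_dilation w b T.
Proof.
move=> b0 mw wK.
exists (fun x => L2class (L2Fun (weighted_dilation_L2 (repr x) b0 mw wK))) => x.
have := repr_L2class (L2Fun (weighted_dilation_L2 (repr x) b0 mw wK)).
by apply: filterS => t /= /(_ I).
Qed.

Lemma W_weighted_dilation (a : R) (a01 : 0 < a < 1) :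
  is_weighted_dilation (fun t => expR (- (t * (1 - a)))) a (W a01).
Proof.
move=> x; have := repr_L2class (L2Fun (Wfun_L2 (repr x) a01)).
by apply: filterS => t /= /(_ I).
Qed.

Section operator.
Variables (w : R -> R) (b : R) (T : L2 mu -> L2 mu).
Hypotheses (b0 : 0 < b) (Tw : is_weighted_dilation w b T).

Lemma weighted_dilation_linear (k : R[i]) x y : T (k *: x + y) = k *: T x + T y.
Proof.
apply: repr_ae_inj.
have h := ae_dilation b0 (reprD_ae k x y).
apply: (filterS3 _ _ (Tw (k *: x + y)) (filterI (Tw x) (Tw y))
  (filterI h (reprD_ae k (T x) (T y)))) => t -> [hx hy] [e ->].
by rewrite hx hy /weighted_dilation e mulrDr mulrCA.
Qed.

(** Bounding w only where x(bt) is nonzero is what makes the norm of a weighted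
dilation depend on the support of x. *)
Lemma weighted_dilation_le (K : R) x : 0 <= K ->
  (\forall t \ae mu, repr x (b * t) <> 0 -> `|w t| <= K) ->
  nrm (T x) <= K / Num.sqrt b * nrm x.
Proof.
move=> K0 wK.
have s0 : 0 < Num.sqrt b by rewrite sqrtr_gt0.
rewrite -(@ler_pXn2r _ 2)// ?nnegrE ?nrm_ge0//; last first.
  by rewrite mulr_ge0 ?nrm_ge0// divr_ge0// ltW.
rewrite !exprMn exprVn sqr_sqrtr ?(ltW b0)// -lee_fin [leRHS]EFinM !nrm_L2 !L2fun_norm_sqr.
apply: integral_dilation_le => //; [exact: (L2funP _).1|exact: (L2funP _).1|].
apply: (filterS2 _ _ (Tw x) wK) => t -> wt; rewrite /weighted_dilation.
rewrite normcM normc_real.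
have [->|/eqP x0] := eqVneq (repr x (b * t)) 0; first by rewrite normc0 !mulr0.
by rewrite ler_wpM2r ?normc_ge0// wt.
Qed.

Lemma weighted_dilation_bounded (K : R) : (forall t, 0 < t -> `|w t| <= K) ->
  bounded_operator_on setT T.
Proof.
move=> wK; split=> //; first by move=> k x y _ _; exact: weighted_dilation_linear.
exists (K / Num.sqrt b) => x _; rewrite !nrmE -rmorphM lecR; apply: weighted_dilation_le.
  exact: le_trans (wK 1 ltr01).
by apply: filterS (ae_Rplus R) => t t0 _; exact: wK.
Qed.

End operator.

Definition supported A x := \forall t \ae mu, ~ A t -> repr x t = 0.

Lemma supported_sub A B x : (forall t, 0 < t -> A t -> B t) ->
  supported A x -> supported B x.
Proof.
move=> AB Ax; apply: (filterS2 _ _ (ae_Rplus R) Ax) => t t0 At Bt; apply: At => At.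
by apply: Bt; exact: AB.
Qed.

Lemma weighted_dilation_supported w b T A x : 0 < b -> is_weighted_dilation w b T ->
  supported A x -> supported ( *%R b @^-1` A) (T x).
Proof.
move=> b0 Tw /(ae_dilation b0) Ax; apply: (filterS2 _ _ (Tw x) Ax) => t -> /= h /h.
by rewrite /weighted_dilation => ->; rewrite mulr0.
Qed.

(** Composing the dilations by c and b = 1/c leaves the multiplication by
w(t) v(bt), so that it suffices to have w(t) v(bt) = 1 on the support of x. *)
Lemma weighted_dilation_cancel w v (b c : R) T S A x : 0 < b -> c * b = 1 ->
  is_weighted_dilation w b T -> is_weighted_dilation v c S ->
  (forall t, 0 < t -> A t -> w t * v (b * t) = 1) ->
  supported A x -> T (S x) = x.
Proof.
move=> b0 cb Tw Sv wv Ax; apply: repr_ae_inj.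
apply: (filterS3 _ _ (filterI (ae_Rplus R) Ax) (Tw (S x)) (ae_dilation b0 (Sv x))).
move=> t [t0 At] -> /=; rewrite /weighted_dilation => ->.
rewrite mulrA -rmorphM mulrA cb mul1r.
have [{}/(wv _ t0)->|{}/At->] := pselect (A t); first by rewrite mul1r.
by rewrite mulr0.
Qed.

Lemma restriction_exists A : measurable A -> exists2 P : L2 mu -> L2 mu,
  is_weighted_dilation (\1_A : R -> R) 1 P & forall x, nrm (P x) <= nrm x.
Proof.
move=> mA.
have m1 : measurable_fun [set: measurableTypeR R] (\1_A : measurableTypeR R -> R).
  exact: measurable_indic.
have le1 t : `|\1_A t : R| <= 1.
  by rewrite indicE; case: (t \in A); rewrite ?normr0 ?normr1.
have [P Pw] := weighted_dilation_exists ltr01 m1 (fun t _ => le1 t).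
exists P => // x; have := @weighted_dilation_le _ _ _ ltr01 Pw 1 x ler01.
by rewrite sqrtr1 divr1 mul1r; apply; apply: nearW => t _; exact: le1.
Qed.

Lemma restriction_repr A P x : is_weighted_dilation (\1_A : R -> R) 1 P ->
  \forall t \ae mu, repr (P x) t = if t \in A then repr x t else 0.
Proof.
move=> /(_ x); apply: filterS => t ->; rewrite /weighted_dilation mul1r indicE.
by case: (t \in A); rewrite ?mul1r ?mul0r.
Qed.

(** This exhibits the functions supported in A as the kernel of an operator of norm at
most 1, whence a closed subspace. *)
Lemma supportedE A P x : is_weighted_dilation (\1_(~` A) : R -> R) 1 P ->
  supported A x <-> P x = 0.
Proof.
move=> /restriction_repr-/(_ x) Px; split=> [Ax|P0].
  apply: repr_ae_inj; apply: (filterS3 _ _ Px Ax repr0_ae) => t -> At ->.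
  by case: ifPn => //; rewrite inE; exact: At.
apply: (filterS2 _ _ Px repr0_ae) => t; rewrite P0 => -> At nAt.
by move: At; rewrite mem_set.
Qed.

Lemma supported_closed_subspace A : measurable A ->
  closed_linear_subspace (supported A).
Proof.
move=> mA; have [P PA P1] := restriction_exists (measurableC mA).
have PE x := supportedE x PA.
have Pl := weighted_dilation_linear ltr01 PA.
split.
- move=> x xA; apply/PE/nrm_le0/ler_addgt0Pl => e e0; rewrite addr0.
  have [y [/PE Py xy]] := xA _ (near_nrm x e0).
  apply: le_trans (ltW xy); apply: le_trans (P1 _).
  by rewrite addrC -scaleN1r Pl Py scaler0 add0r.
- by apply: filterS repr0_ae.
- by move=> k x y /PE Px /PE Py; apply/PE; rewrite Pl Px Py scaler0 addr0.
Qed.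

Lemma supported_decomposition A : measurable A ->
  direct_sum_decomposition (supported (~` A)) (supported A).
Proof.
move=> mA; split.
  apply/seteqP; split=> [x [nAx Ax]|_ ->]; last first.
    by split; apply: filterS repr0_ae.
  apply: repr_ae_inj; apply: (filterS3 _ _ nAx Ax repr0_ae) => t h1 h2 ->.
  by have [At|nAt] := pselect (A t); [apply: h1|exact: h2].
move=> x; have [P /restriction_repr PA _] := restriction_exists mA.
exists ((-1) *: P x + x), (P x); split.
- apply: (filterS2 _ _ (reprD_ae (-1) (P x) x) (PA x)) => t -> -> nAt.
  have At : A t by exact: contrapT.
  by rewrite mem_set// mulN1r addNr.
- by apply: filterS (PA x) => t -> nAt; rewrite memNset.
- by rewrite scaleN1r addrAC addNr add0r.
Qed.

End weighted_dilation.

(** * Hyperbolic splitting at a cut point *)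

Section dilation_spectral_radius.
Variable R : realType.
Local Notation mu := (@lebesgue_Rplus R).

(** The norm estimate on the functions supported in A turned into a bound of the
spectral radius. The conclusion is about an S that agrees with T on these
functions because the inverse of W on N is a partial inverse, whose values
outside the image are arbitrary. *)
Lemma weighted_dilation_spectral_radius_lt1 (w : R -> R) (b C K : R) (T S : L2 mu -> L2 mu)
    (A : set (measurableTypeR R)) :
  0 < b -> is_weighted_dilation w b T -> measurable A ->
  (forall t, 0 < t -> `|w t| <= C) ->
  (forall x, supported A x -> supported A (T x)) ->
  (forall x, supported A x -> S x = T x) ->
  0 <= K -> (forall t, 0 < t -> A (b * t) -> `|w t| <= K) ->
  K / Num.sqrt b < 1 -> (spectral_radius_on (supported A) S < 1)%E.
Proof.
move=> b0 Tw mA wC TA ST K0 wK Kb.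
have Asub := supported_closed_subspace mA.
have [_ Tl [D TD]] := weighted_dilation_bounded b0 Tw wC.
apply: le_lt_trans (_ : ((K / Num.sqrt b)%:E < 1)%E); last by rewrite lte_fin.
have /= := @spectral_radius_on_le _ _ (supported A) S (K / Num.sqrt b).
apply=> //.
- split=> [x Ax|k x y Ax Ay|].
  + by rewrite ST//; exact: TA.
  + have [_ _ Al] := Asub.
    by rewrite !ST ?Tl//; exact: Al.
  + by exists D => x Ax; rewrite ST// TD.
- by rewrite divr_ge0// sqrtr_ge0.
- move=> x Ax; rewrite ST//; apply: (weighted_dilation_le b0 Tw) => //.
  apply: (filterS2 (ae_filter_ringOfSetsType mu) _ (ae_Rplus R) (ae_dilation b0 Ax)).
  move=> t t0 At xt; apply: wK => //; exact: contra_notP xt.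
Qed.

(** With L = - ln (sqrt a), the two conditions say a L < c (1 - a) < L; the
midpoint of this interval is chosen for c (1 - a). *)
Lemma cut_exists (a : R) : 0 < a < 1 -> exists c : R,
  [/\ 0 < c, expR (c * (1 - a)) * Num.sqrt a < 1 &
      expR (- (c * (1 - a) / a)) / Num.sqrt a < 1].
Proof.
move=> /andP[a0 a1].
have a1' : 0 < 1 - a by rewrite subr_gt0.
have s0 : 0 < Num.sqrt a by rewrite sqrtr_gt0.
have s1 : Num.sqrt a < 1 by rewrite -sqrtr1 ltr_sqrt.
pose L := - ln (Num.sqrt a).
have L0 : 0 < L by rewrite oppr_gt0 ln_lt0// s0.
have sE : Num.sqrt a = expR (- L) by rewrite opprK lnK.
exists (L * (1 + a) / 2 / (1 - a)); split.
- by rewrite !divr_gt0// mulr_gt0// addr_gt0.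
- rewrite divfK ?gt_eqF// sE -expRD expR_lt1.
  by nra.
- rewrite divfK ?gt_eqF// sE -expRN -expRD opprK expR_lt1 addrC subr_lt0.
  by rewrite ltr_pdivlMr//; nra.
Qed.

End dilation_spectral_radius.

Theorem theorem3p6 (R : realType) (a : R) (a01 : 0 < a < 1) :
  generalized_hyperbolic (W a01).
Proof.
have /andP[a0 a1] := a01.
have a1' : 0 < 1 - a by rewrite subr_gt0.
have ai0 : 0 < a^-1 by rewrite invr_gt0.
have aia : a^-1 * a = 1 by rewrite mulVf// gt_eqF.
have aai : a * a^-1 = 1 by rewrite mulrC.
have [c [c0 cN cM]] := cut_exists a01.
have Ww := W_weighted_dilation a01.
set w := (fun t => expR _) in Ww.
have w1 t : 0 < t -> `|w t| <= 1.
  move=> t0; rewrite ger0_norm ?expR_ge0// expR_le1 oppr_le0.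
  by rewrite mulr_ge0// ltW.
(* Truncating the exponent at c makes the weight of the inverse bounded, hence
   an operator on the whole space, without changing it on t <= c. *)
pose v t : R := expR (Num.min t c * ((1 - a) / a)).
have vC t : 0 < t -> `|v t| <= expR (c * ((1 - a) / a)).
  move=> _; rewrite ger0_norm ?expR_ge0// ler_expR ler_wpM2r//.
    by rewrite divr_ge0// ltW.
  by rewrite ge_min lexx orbT.
have mv : measurable_fun [set: measurableTypeR R] (v : measurableTypeR R -> R).
  apply: measurableT_comp => //; apply: measurable_funM => //.
  exact: measurable_minr.
have [B Bv] := weighted_dilation_exists ai0 mv vC.
pose Iic (r : R) : set (measurableTypeR R) := `]-oo, r]%classic.
have mI r : measurable (Iic r) by exact: measurable_itv.
have IicE r t : Iic r t = (t <= r) by rewrite /Iic /= in_itv.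
have WB y : supported (Iic (c / a)) y -> W a01 (B y) = y.
  apply: (weighted_dilation_cancel a0 aia Ww Bv) => t t0; rewrite IicE => tc.
  rewrite /v min_l; last by rewrite mulrC -ler_pdivlMr.
  rewrite -expRD -[RHS]expR0; congr expR.
  by field; rewrite gt_eqF.
have BW x : supported (Iic c) x -> B (W a01 x) = x.
  apply: (weighted_dilation_cancel ai0 aai Bv Ww) => t t0; rewrite IicE => tc.
  rewrite /v min_l// -expRD -[RHS]expR0; congr expR.
  by field; rewrite gt_eqF.
have WI x : supported (Iic c) x -> supported (Iic (c / a)) (W a01 x).
  move=> /(weighted_dilation_supported a0 Ww); apply: supported_sub => t _ /=.
  by rewrite !IicE ler_pdivlMr// mulrC.
have BI y : supported (Iic (c / a)) y -> supported (Iic c) (B y).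
  move=> /(weighted_dilation_supported ai0 Bv); apply: supported_sub => t _ /=.
  by rewrite !IicE mulrC ler_pM2r.
have cca : c <= c / a.
  by rewrite ler_pdivlMr// ler_piMr// ltW.
have II x : supported (Iic c) x -> supported (Iic (c / a)) x.
  by apply: supported_sub => t _; rewrite !IicE => /le_trans; exact.
have imW : W a01 @` supported (Iic c) = supported (Iic (c / a)).
  apply/seteqP; split=> [_ [x Ix <-]|y Iy]; first exact: WI.
  by exists (B y); [exact: BI|exact: WB].
have Winj : set_inj (supported (Iic c)) (W a01).
  by move=> x y /set_mem/BW {2}<- /set_mem/BW {2}<- ->.
have WM x : supported (~` Iic c) x -> supported (~` Iic c) (W a01 x).
  move=> /(weighted_dilation_supported a0 Ww); apply: supported_sub => t t0 /=.
  rewrite !IicE => /negP; rewrite -ltNge => h; apply/negP; rewrite -ltNge.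
  by apply: lt_le_trans h _; rewrite ler_piMl// ltW.
split; first exact: (weighted_dilation_bounded a0 Ww w1).
(* The measure of ]-oo, 0] is 0, so ]-oo, c] stands for ]0, c]. *)
exists (supported (~` Iic c)), (supported (Iic c)); split.
- by split; apply: supported_closed_subspace => //; exact: measurableC.
- exact: supported_decomposition.
- split; first by move=> _ [x Mx <-]; exact: WM.
  apply: (weighted_dilation_spectral_radius_lt1 a0 Ww _ w1 WM _ _ _ cM) => //.
    exact: measurableC.
  move=> t t0 /=; rewrite IicE => /negP; rewrite -ltNge => h.
  rewrite ger0_norm ?expR_ge0// ler_expR lerN2 ler_pdivrMr//.
  by rewrite mulrAC ler_pM2r// mulrC ltW.
rewrite imW; split.
- by split=> //; rewrite -imW.
- by have [] := supported_closed_subspace (mI (c / a)).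
- exact: II.
apply: (weighted_dilation_spectral_radius_lt1 ai0 Bv (mI c) vC _ _ (expR_ge0 (c * (1 - a)))).
- by move=> x /II; exact: BI.
- move=> y Iy; have Wy : (W a01 @` supported (Iic c)) y by rewrite imW; exact: II.
  rewrite -{2}[y](pinvK (fun=> point) (mem_set Wy)) BW//.
  have sW : set_surj (supported (Iic c)) (W a01 @` supported (Iic c)) (W a01) by [].
  by apply: (surjpinv_image_sub sW); exists y.
- move=> t t0; rewrite IicE => h; rewrite ger0_norm ?expR_ge0// ler_expR.
  have ta : t <= c * a by rewrite -ler_pdivrMr// mulrC.
  rewrite /v min_l; last by rewrite (le_trans ta)// ler_piMr// ltW.
  have -> : t * ((1 - a) / a) = a^-1 * t * (1 - a) by field; rewrite gt_eqF.
  by rewrite ler_pM2r.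
by rewrite sqrtrV ?invrK// ltW.
Qed.
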